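(* We have the $\mathrm{des}$-Wilf equivalence $\underline{132}4\overset{\mathrm{des}}{\sim}\underline{142}3$.
   Context: $\mathfrak{S}_n$ is the set of permutations of $\{1,\ldots,n\}$ in one-line notation, and $\mathrm{des}(\pi)=|\{i\in[n-1]:\pi_i>\pi_{i+1}\}|$. An occurrence of the pattern $\underline{abc}d$ (where $abcd\in\mathfrak{S}_4$) in $\pi$ is a subsequence $\pi_i\pi_{i+1}\pi_{i+2}\pi_j$ with $j>i+2$ order-isomorphic to $abcd$. $\mathfrak{S}_n(\omega)$ is the set of permutations in $\mathfrak{S}_n$ with no occurrence of $\omega$. $\omega\overset{\mathrm{des}}{\sim}\omega'$ means $|\{\pi\in\mathfrak{S}_n(\omega):\mathrm{des}(\pi)=m\}|=|\{\pi\in\mathfrak{S}_n(\omega'):\mathrm{des}(\pi)=m\}|$ for all $n\ge1$ and $m\ge0$. *)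

(* Defs.v *)
From mathcomp Require Import all_boot all_fingroup.

Set Implicit Arguments.
Unset Strict Implicit.
Unset Printing Implicit Defensive.

(* A permutation pi of {1, ..., n} is represented by p : 'S_n acting on
   'I_n = {0, ..., n-1}, with pi_(i+1) = p i + 1.  Descents and pattern
   occurrences only compare positions and values, so the shift by one is
   harmless. *)

Definition des (n : nat) (p : 'S_n) : nat :=
  #|[set i : 'I_n | [exists j : 'I_n, (j == i.+1 :> nat) && (p j < p i)]]|.

Definition order_iso (k : nat) (s t : k.-tuple nat) : bool :=
  [forall a : 'I_k, forall b : 'I_k,
    (tnth s a < tnth s b) == (tnth t a < tnth t b)].

(* w = [tuple a; b; c; d] stands for the vincular pattern \underline{abc}d:
   the first three letters must be adjacent. *)
Definition occurrence (w : 4.-tuple nat) (n : nat) (p : 'S_n)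
    (i1 i2 i3 j : 'I_n) : bool :=
  [&& i2 == i1.+1 :> nat, i3 == i1.+2 :> nat, i1.+2 < j
    & order_iso [tuple p i1 : nat; p i2 : nat; p i3 : nat; p j : nat] w].

Definition avoids (w : 4.-tuple nat) (n : nat) (p : 'S_n) : bool :=
  ~~ [exists i1 : 'I_n, exists i2 : 'I_n, exists i3 : 'I_n, exists j : 'I_n,
       occurrence w p i1 i2 i3 j].

Definition avoiders (w : 4.-tuple nat) (n : nat) : {set 'S_n} :=
  [set p | avoids w p].

Definition des_Wilf_equiv (w w' : 4.-tuple nat) : Prop :=
  forall n m : nat, 1 <= n ->
    #|[set p in avoiders w n | des p == m]|
    = #|[set p in avoiders w' n | des p == m]|.

(* Main.v *)
(** The Lehmer code a_i = #{j > i : pi_j < pi_i} is a bijection from S_n onto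
    the words with a_i <= n - i, and descents of pi are descents of its code.
    Three adjacent letters of pi form a 132 iff their codes a, k, l satisfy
    a <= l < k.  In that case the middle letter exceeds every later one iff k is
    the largest value allowed at its position, and no later letter lies between
    the third and the middle one iff k = l + 1.  So both avoidance classes
    prescribe k as a function g of l and of the position whenever a <= l < k.
    Overwriting k by its prescribed value, from left to right, passes from one
    rule to the other: all that is used of g is that g > l is a legal code letter,
    so the descent from k to l is kept, the first letter never changes, and the
    two overwritings, restricted to the two classes, are mutually inverse. *)

Require Import Defs.
From mathcomp Require Import all_boot all_fingroup.
From mathcomp Require Import zify.

Set Implicit Arguments.
Unset Strict Implicit.
Unset Printing Implicit Defensive.

(** Two induction hypotheses are provided because [move_peaks] resumes either at [k] or, having
    overwritten [k], at [l]. *)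
Lemma seq_ind3 (T : Type) (P : seq T -> Prop) :
  P [::] -> (forall a, P [:: a]) -> (forall a b, P [:: a; b]) ->
  (forall a k l r, P (l :: r) -> P [:: k, l & r] -> P [:: a, k, l & r]) ->
  forall s, P s.
Proof.
move=> P0 P1 P2 P3 s.
elim: {s}(size s).+1 {-2}s (ltnSn (size s)) => // n IHn.
by case=> [|a [|k [|l r]]] //= lt_rn; apply: P3; apply: IHn => /=; lia.
Qed.

(** * Lehmer codes as bounded words *)

Fixpoint is_code (s : seq nat) : bool :=
  if s is a :: s' then (a <= size s') && is_code s' else true.

Fixpoint codes (n : nat) : seq (seq nat) :=
  if n is m.+1 then [seq a :: s | a <- iota 0 n, s <- codes m] else [:: [::]].

Lemma mem_codes n s : (s \in codes n) = (size s == n) && is_code s.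
Proof.
elim: n s => [|n IHn] [|a s]; rewrite ?inE //.
  by apply/negP => /allpairsP[[b t] /= [_ _]].
apply/allpairsP/andP => [[[b t] [lt_b t_in [-> ->]]]|[/= sz_s /andP[le_a s_code]]].
  move: lt_b t_in; rewrite mem_iota IHn /= => lt_b /andP[/eqP-> ->].
  by rewrite eqxx andbT.
exists (a, s); split=> //=; first by rewrite inE mem_iota; lia.
by rewrite IHn s_code andbT.
Qed.

Lemma codes_uniq n : uniq (codes n).
Proof.
elim: n => // n IHn.
by apply: allpairs_uniq => //; [apply: iota_uniq | move=> [a s] [b t] _ _ /= [-> ->]].
Qed.

Lemma size_codes n : size (codes n) = n`!.
Proof. by elim: n => // n IHn; rewrite size_allpairs size_iota IHn factS. Qed.

(** * Descents of a code and overwriting of its peaks *)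

Fixpoint code_des (s : seq nat) : nat :=
  if s is a :: s' then (if s' is b :: _ then b < a : nat else 0) + code_des s'
  else 0.

(* [g m l] is the code letter required in the middle of a 132 whose third letter
   has code [l] and is followed by [m] letters. *)
Fixpoint peaks_at (g : nat -> nat -> nat) (s : seq nat) : bool :=
  if s is a :: s' then
    (if s' is [:: k, l & r] then (a <= l < k) ==> (k == g (size r) l) else true)
      && peaks_at g s'
  else true.

(** After an overwriting the scan resumes at [l]: as [l < k], the triple that starts with [k] cannot
    satisfy [k <= m < l], so [l] is not overwritten. *)
Fixpoint move_peaks (g : nat -> nat -> nat) (s : seq nat) : seq nat :=
  if s is a :: s' then
    a :: (if s' is k :: t then
            if t is l :: r then
              if a <= l < k then g (size r) l :: move_peaks g t
              else move_peaks g s'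
            else s'
          else s')
  else [::].

Lemma move_peaks_short g s : size s < 3 -> move_peaks g s = s.
Proof. by case: s => [|a [|k [|]]]. Qed.

Lemma move_peaks_cons3 g a k l r : move_peaks g [:: a, k, l & r] =
  a :: (if a <= l < k then g (size r) l :: move_peaks g (l :: r)
        else move_peaks g [:: k, l & r]).
Proof. by []. Qed.

Lemma move_peaks_cons g a s :
  move_peaks g (a :: s) = a :: behead (move_peaks g (a :: s)).
Proof. by []. Qed.

Opaque move_peaks.

(** The overwritten letter is followed by [l] and [m] further letters, so [m.+1] is the largest code
    letter allowed there. *)
Definition peak_rule (g : nat -> nat -> nat) : Prop :=
  forall m l, l <= m -> l < g m l <= m.+1.

Section MovePeaks.

Variable g : nat -> nat -> nat.
Hypothesis g_rule : peak_rule g.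

Lemma size_move_peaks s : size (move_peaks g s) = size s.
Proof.
elim/seq_ind3: s => [|a|a b|a k l r IHl IHk]; try by rewrite move_peaks_short.
by rewrite move_peaks_cons3; case: ifP; rewrite /= ?IHl ?IHk.
Qed.

(** The letter [l] changes only if [k <= m < l] for the next letter [m], and its new value exceeds
    [m], hence [k]. So the test [a <= l < k] has the same outcome after the rest of the word is
    rewritten. *)
Lemma move_peaks_cons2 k l r : exists l' r',
  [/\ move_peaks g [:: k, l & r] = [:: k, l' & r'], size r' = size r
    & is_code (l :: r) -> (l < k -> l' = l) /\ (k <= l -> k <= l')].
Proof.
case: r => [|m r]; first by exists l, [::]; rewrite move_peaks_short.
rewrite move_peaks_cons3; case: ifP => [/andP[le_km lt_ml]|_].
  exists (g (size r) m), (move_peaks g (m :: r)); split=> //.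
    exact: size_move_peaks.
  by move=> /and3P[_ /g_rule/andP[lt_mg _] _]; split; lia.
exists l, (behead (move_peaks g [:: l, m & r])); split=> //.
by rewrite size_behead size_move_peaks.
Qed.

Lemma move_peaks_is_code s : is_code s -> is_code (move_peaks g s).
Proof.
elim/seq_ind3: s => [|a|a b|a k l r IHl IHk]; try by rewrite move_peaks_short.
move=> /andP[le_a code_k].
rewrite move_peaks_cons3; case: ifP => _.
  have code_l : is_code (l :: r) by case/andP: code_k.
  rewrite /= size_move_peaks IHl // andbT /=; move: le_a => /= ->.
  by case/andP: code_l => /g_rule/andP[].
by rewrite [is_code _]/= IHk // size_move_peaks andbT.
Qed.

Lemma code_des_move_peaks s : is_code s -> code_des (move_peaks g s) = code_des s.
Proof.
elim/seq_ind3: s => [|a|a b|a k l r IHl IHk]; try by rewrite move_peaks_short.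
move=> code_s.
have code_k : is_code [:: k, l & r] by case/andP: code_s.
have code_l : is_code (l :: r) by case/andP: code_k.
have /g_rule/andP[lt_lg _] : l <= size r by case/andP: code_l.
have := IHk code_k; have := IHl code_l.
have [l' [r' [E _ _]]] := move_peaks_cons2 k l r.
rewrite move_peaks_cons3 E.
case: ifP => [/andP[le_al lt_lk]|_] IHl' IHk'; last first.
  by rewrite [RHS]/= -/(code_des [:: k, l & r]) -IHk'.
(* Both [k] and its replacement exceed [l >= a]: no descent from [a], and one descent to [l], before
   and after. *)
by move: IHl'; rewrite (move_peaks_cons g l r) /= => ->; lia.
Qed.

Lemma peaks_at_move_peaks s : is_code s -> peaks_at g (move_peaks g s).
Proof.
elim/seq_ind3: s => [|a|a b|a k l r IHl IHk]; try by rewrite move_peaks_short.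
move=> code_s.
have code_k : is_code [:: k, l & r] by case/andP: code_s.
have code_l : is_code (l :: r) by case/andP: code_k.
have /g_rule/andP[lt_lg _] : l <= size r by case/andP: code_l.
have := IHk code_k; have := IHl code_l.
have [l' [r' [E sz_r' le_l']]] := move_peaks_cons2 k l r.
have [lt_l le_l] := le_l' code_l.
have := size_move_peaks (l :: r).
rewrite move_peaks_cons3 E move_peaks_cons; set t := behead _ => -[sz_t].
case: ifP => [/andP[le_al lt_lk] pl _|al_k _ pk].
  rewrite /= in pl *; rewrite sz_t eqxx implybT pl andbT.
  (* The new letter exceeds [l], so it cannot start a peak with middle [l]. *)
  by case: (t) => [|m t'] //; apply/implyP; lia.
rewrite /= in pk *; rewrite pk andbT; apply/implyP; lia.
Qed.

(** Overwriting by [g] preserves the places of the peaks, so overwriting by [h] acts at the same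
    places and restores the values that [s], obeying [h], had there. *)
Lemma move_peaksK h s :
  is_code s -> peaks_at h s -> move_peaks h (move_peaks g s) = s.
Proof.
elim/seq_ind3: s => [|a|a b|a k l r IHl IHk]; try by rewrite move_peaks_short.
move=> code_s peak_s.
have code_k : is_code [:: k, l & r] by case/andP: code_s.
have code_l : is_code (l :: r) by case/andP: code_k.
have /g_rule/andP[lt_lg _] : l <= size r by case/andP: code_l.
have peak_k : peaks_at h [:: k, l & r] by case/andP: peak_s.
have peak_l : peaks_at h (l :: r) by case/andP: peak_k.
have /implyP peak_a : (a <= l < k) ==> (k == h (size r) l).
  by case/andP: peak_s.
have := IHk code_k peak_k; have := IHl code_l peak_l.
have [l' [r' [E sz_r' le_l']]] := move_peaks_cons2 k l r.
have [lt_l le_l] := le_l' code_l.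
have := size_move_peaks (l :: r).
rewrite move_peaks_cons3 E move_peaks_cons; set t := behead _ => -[sz_t].
case: ifP => [al_k hl _|al_k _ hk].
  rewrite move_peaks_cons3 hl sz_t.
  have -> : a <= l < g (size r) l by lia.
  by rewrite -(eqP (peak_a al_k)).
rewrite move_peaks_cons3.
have -> : (a <= l' < k) = false by lia.
by rewrite hk.
Qed.

End MovePeaks.

(** Overwriting by [h] maps the first family into the second, and is injective there because
    overwriting by [g] undoes it. *)
Lemma leq_count_peaks_at g h n m : peak_rule g -> peak_rule h ->
  count (fun s => peaks_at g s && (code_des s == m)) (codes n)
  <= count (fun s => peaks_at h s && (code_des s == m)) (codes n).
Proof.
move=> g_rule h_rule; rewrite -!size_filter -(size_map (move_peaks h)).
apply: uniq_leq_size => [|_ /mapP[s + ->]].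
  rewrite map_inj_in_uniq ?filter_uniq ?codes_uniq // => s t.
  rewrite !mem_filter !mem_codes => /and3P[/andP[ps _] _ cs] /and3P[/andP[pt _] _ ct].
  by move/(congr1 (move_peaks g)); rewrite !move_peaksK.
rewrite !mem_filter !mem_codes => /and3P[/andP[_ des_s] sz_s code_s].
by rewrite peaks_at_move_peaks // code_des_move_peaks // size_move_peaks
  move_peaks_is_code // des_s sz_s.
Qed.

(** * Positionwise descriptions of codes, descents and peaks *)

Lemma is_codeP s :
  reflect (forall i, i < size s -> nth 0 s i + i < size s) (is_code s).
Proof.
elim: s => [|a s IHs] /=; first by left.
apply: (iffP andP) => [[le_a /IHs lt_s] [|i] lt_i|lt_s].
- by rewrite /=; lia.
- by have /= := lt_s i lt_i; lia.
split; first by have /= := lt_s 0 isT; lia.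
by apply/IHs => i lt_i; have /= := lt_s i.+1 lt_i; lia.
Qed.

Lemma code_desE s :
  code_des s = \sum_(i < size s) ((i.+1 < size s) && (nth 0 s i.+1 < nth 0 s i)).
Proof.
elim: s => [|a s IHs]; first by rewrite big_ord0.
by rewrite big_ord_recl /= IHs; case: s {IHs}.
Qed.

Lemma peaks_atP g s :
  reflect (forall i, i.+2 < size s ->
             nth 0 s i <= nth 0 s i.+2 < nth 0 s i.+1 ->
             nth 0 s i.+1 = g (size s - i.+3) (nth 0 s i.+2))
          (peaks_at g s).
Proof.
elim: s => [|a s IHs]; first by left.
apply: (iffP andP) => [[ps /IHs IH] [|i] // lt_i|ps].
- by case: s ps lt_i {IHs IH} => [|k [|l r]] //= /implyP + _ lel => /(_ lel) /eqP->;
    congr g; lia.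
- exact: IH.
split; last by apply/IHs => i; apply: (ps i.+1).
case: s ps {IHs} => [|k [|l r]] //= ps; apply/implyP => lel.
by have /= -> := ps 0 isT lel; apply/eqP; congr g; lia.
Qed.

(** * The two patterns as chains of inequalities *)

Lemma forallb_ord0 (P : pred 'I_0) : [forall i, P i] = true.
Proof. by apply/forallP => -[]. Qed.

Lemma forallb_ordSl n (P : pred 'I_n.+1) :
  [forall i, P i] = P ord0 && [forall i, P (lift ord0 i)].
Proof.
apply/forallP/andP => [Pi|[P0 /forallP Pl] i].
  by split; last by apply/forallP.
by case: (unliftP ord0 i) => [j|] ->.
Qed.

Lemma order_iso1324 (x1 x2 x3 x4 : nat) :
  order_iso [tuple x1; x2; x3; x4] [tuple 1; 3; 2; 4] = [&& x1 < x3, x3 < x2 & x2 < x4].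
Proof.
by rewrite /order_iso !forallb_ordSl !forallb_ord0 /tnth /=; lia.
Qed.

Lemma order_iso1423 (x1 x2 x3 x4 : nat) :
  order_iso [tuple x1; x2; x3; x4] [tuple 1; 4; 2; 3] = [&& x1 < x3, x3 < x4 & x4 < x2].
Proof.
by rewrite /order_iso !forallb_ordSl !forallb_ord0 /tnth /=; lia.
Qed.

(** * Lehmer codes of permutations *)

Section Lehmer.

Variable n : nat.
Implicit Types (p q : 'S_n) (i j k : 'I_n).

Definition below p i : {set 'I_n} := [set j : 'I_n | (i < j) && (p j < p i)].

Definition lehmer p : seq nat := [seq #|below p i| | i <- enum 'I_n].

Lemma size_lehmer p : size (lehmer p) = n.
Proof. by rewrite size_map size_enum_ord. Qed.

Lemma nth_lehmer p i : nth 0 (lehmer p) i = #|below p i|.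
Proof. by rewrite (nth_map i) ?size_enum_ord // nth_ord_enum. Qed.

Lemma perm_ltnNge p i j : i != j :> nat -> (p i < p j) = ~~ (p j < p i).
Proof.
move=> ij; rewrite -leqNgt ltn_neqAle (inj_eq val_inj) (inj_eq perm_inj).
by rewrite -(inj_eq val_inj) ij.
Qed.

Lemma card_later i : #|[set j : 'I_n | i < j]| = n - i.+1.
Proof.
have -> : [set j : 'I_n | i < j] = ~: [set j : 'I_n | j < i.+1].
  by apply/setP => j; rewrite !inE -leqNgt.
have := cardsC [set j : 'I_n | j < i.+1]; rewrite card_ord.
suff -> : #|[set j : 'I_n | j < i.+1]| = i.+1 by lia.
rewrite cardsE -sum1_card -(big_ord_widen _ (fun=> 1)) // sum1_card card_ord //.
Qed.

Lemma lehmer_is_code p : is_code (lehmer p).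
Proof.
apply/is_codeP => i; rewrite size_lehmer => lt_i.
rewrite (nth_lehmer p (Ordinal lt_i)).
have : #|below p (Ordinal lt_i)| <= n - i.+1.
  rewrite -(card_later (Ordinal lt_i)); apply: subset_leq_card.
  by apply/subsetP => j; rewrite !inE => /andP[].
lia.
Qed.

Lemma below_leq_of_agree p q i : (forall j, j < i -> p j = q j) ->
  p i < q i -> #|below p i| < #|below q i|.
Proof.
move=> agree lt_pq.
have notin : i \notin below p i by rewrite inE ltnn.
have -> : #|below p i|.+1 = #|i |: below p i| by rewrite cardsU1 notin.
(* Each [j] goes to the position where [q] takes the value [p j]. For [j] in [i |: below p i] that
   position lies after [i]: agreement excludes earlier ones, and [p j < q i] excludes [i]. *)
have inj : injective (fun j => (q^-1)%g (p j)) by move=> j k /perm_inj/perm_inj.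
rewrite -(card_imset _ inj); apply: subset_leq_card.
apply/subsetP => _ /imsetP[j + ->]; rewrite !inE permKV => ij.
have le_ij : i <= j by case/orP: ij => [/eqP->|/andP[/ltnW]].
have lt_j : p j < q i by case/orP: ij => [/eqP->|/andP[_]] //; move/ltn_trans; apply.
rewrite lt_j andbT ltn_neqAle; apply/andP; split.
  by apply: contraTneq lt_j => /val_inj Ei; rewrite -[p j](permKV q) -Ei ltnn.
rewrite leqNgt; apply/negP => lt_i.
have := agree _ lt_i; rewrite permKV => /perm_inj Ej; move: lt_i; rewrite Ej; lia.
Qed.

Lemma lehmer_inj : injective lehmer.
Proof.
move=> p q eq_pq; have eq_b i : #|below p i| = #|below q i|.
  by rewrite -!nth_lehmer eq_pq.
suff agree m : forall i, i < m -> p i = q i by apply/permP => i; apply: (agree n).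
elim: m => // m IHm i lt_im.
have agree j : j < i -> p j = q j by move=> lt_ji; apply: IHm; lia.
apply: val_inj; apply/eqP; case: ltngtP => // /below_leq_of_agree.
  by move=> /(_ agree); rewrite eq_b ltnn.
by rewrite eq_b ltnn => -> // j /agree.
Qed.

Lemma card_lehmer (P : pred (seq nat)) :
  #|[set p : 'S_n | P (lehmer p)]| = count P (codes n).
Proof.
have /seq.permP <- : perm_eq [seq lehmer p | p <- enum 'S_n] (codes n).
  have lu : uniq [seq lehmer p | p <- enum 'S_n].
    by rewrite map_inj_uniq ?enum_uniq //; apply: lehmer_inj.
  (* Surjectivity comes from counting: distinct codes, as many as the [n]! available words. *)
  have [||_ eq_lc] := uniq_min_size lu (s2 := codes n).
  - by move=> _ /mapP[p _ ->]; rewrite mem_codes size_lehmer eqxx lehmer_is_code.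
  - by rewrite size_map -cardT card_Sn size_codes.
  by apply: uniq_perm => //; apply: codes_uniq.
rewrite cardE count_map enumT /enum_mem size_filter; apply: eq_count => p.
by rewrite !inE.
Qed.

(** If [p i < p j], the larger letters in between add nothing to [below p i], which thus lies in
    [below p j]; otherwise [below p i] contains [below p j] and also [j]. *)
Lemma below_leq p i j : i < j ->
  (forall k, i < k < j -> (p i < p k) && (p j < p k)) ->
  (#|below p i| <= #|below p j|) = (p i < p j).
Proof.
move=> lt_ij mid; have [lt_p|le_p] := boolP (p i < p j).
  apply: subset_leq_card; apply/subsetP => k; rewrite !inE => /andP[lt_ik lt_k].
  rewrite (ltn_trans lt_k lt_p) andbT ltnNge leq_eqVlt.
  apply/negP => /orP[/eqP/val_inj E|lt_kj]; first by move: lt_k; rewrite E; lia.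
  by have := mid k; rewrite lt_ik lt_kj => /(_ isT); lia.
apply/negbTE; rewrite -ltnNge.
have lt_p : p j < p i by rewrite perm_ltnNge ?le_p //; lia.
have notin : j \notin below p j by rewrite inE ltnn.
have -> : #|below p j|.+1 = #|j |: below p j| by rewrite cardsU1 notin.
apply: subset_leq_card; apply/subsetP => k; rewrite !inE.
by case/orP => [/eqP->|/andP[]]; lia.
Qed.

Lemma below_leqS p i j : j = i.+1 :> nat -> (#|below p i| <= #|below p j|) = (p i < p j).
Proof. by move=> Ej; apply: below_leq => [|k]; rewrite Ej //; lia. Qed.

Lemma below_max p i :
  (#|below p i| == n - i.+1) = [forall j : 'I_n, (i < j) ==> (p j < p i)].
Proof.
have sub : below p i \subset [set j : 'I_n | i < j].
  by apply/subsetP => j; rewrite !inE => /andP[].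
rewrite -card_later eqn_leq subset_leq_card //= (geq_leqif (subset_leqif_cards sub)).
apply/eqP/forallP => [/setP E j|lt_p].
  by apply/implyP => lt_ij; have := E j; rewrite !inE lt_ij.
apply/setP => j; rewrite !inE; have /implyP := lt_p j.
by case: (i < j) => // ->.
Qed.

(** Since [j |: below p j] lies in [below p i], equal cardinality leaves no letter after [j] with
    value between [p j] and [p i]. *)
Lemma below_succ p i j : j = i.+1 :> nat -> p j < p i ->
  (#|below p i| == #|below p j|.+1)
  = [forall k : 'I_n, (j < k) && (p k < p i) ==> (p k < p j)].
Proof.
move=> Ej lt_p.
have notin : j \notin below p j by rewrite inE ltnn.
have -> : #|below p j|.+1 = #|j |: below p j| by rewrite cardsU1 notin.
have sub : j |: below p j \subset below p i.
  by apply/subsetP => k; rewrite !inE => /orP[/eqP->|/andP[]]; lia.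
rewrite eqn_leq (subset_leq_card sub) andbT (geq_leqif (subset_leqif_cards sub)).
apply/eqP/forallP => [/setP E k|lt_k].
  apply/implyP => /andP[lt_jk lt_ki]; have := E k; rewrite !inE.
  have -> : (k == j) = false by apply: contraTF lt_jk => /eqP->; rewrite ltnn.
  by rewrite lt_jk /= lt_ki andbT => ->; lia.
apply/setP => k; rewrite !inE; have /implyP := lt_k k.
have [->|neq] := eqVneq k j; first by lia.
have : (k == j :> nat) = false by apply/negbTE.
lia.
Qed.

(** * Translation of descents and avoidance into codes *)

Lemma code_des_lehmer p : code_des (lehmer p) = des p.
Proof.
rewrite code_desE size_lehmer /des -sum1_card [RHS]big_mkcond.
apply: eq_bigr => i _; rewrite inE.
have [lt_i|le_i] := boolP (i.+1 < n); last first.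
  by case: existsP => // -[j /andP[/eqP E _]]; move: (ltn_ord j); lia.
rewrite (nth_lehmer p i) (nth_lehmer p (Ordinal lt_i)) /= ltnNge below_leqS //.
have E : (~~ (p i < p (Ordinal lt_i))) = (p (Ordinal lt_i) < p i).
  by rewrite -perm_ltnNge //=; lia.
rewrite E; case: existsP => [[j /andP[/eqP Ej]]|ex].
  by rewrite (_ : j = Ordinal lt_i) => [->|]; last exact: val_inj.
by case: (p _ < _) / idP => // lt_p; case: ex; exists (Ordinal lt_i); rewrite /= eqxx.
Qed.

Lemma peaks_at_lehmer g p :
  reflect (forall i1 i2 i3 : 'I_n, i2 = i1.+1 :> nat -> i3 = i1.+2 :> nat ->
             p i1 < p i3 -> p i3 < p i2 ->
             #|below p i2| = g (n - i1.+3) #|below p i3|)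
          (peaks_at g (lehmer p)).
Proof.
have cond i1 i2 i3 : i2 = i1.+1 :> nat -> i3 = i1.+2 :> nat ->
    (#|below p i1| <= #|below p i3| < #|below p i2|) = (p i1 < p i3 < p i2).
  move=> E2 E3; have neq : (p i2 == p i3 :> nat) = false.
    by rewrite (inj_eq val_inj) (inj_eq perm_inj) -(inj_eq val_inj) /=; lia.
  rewrite [X in _ && X]ltnNge (below_leqS p (i := i2)) ?E2 ?E3 //.
  have -> : ~~ (p i2 < p i3) = (p i3 < p i2) by lia.
  have [lt32|] := boolP (p i3 < p i2); last by rewrite !andbF.
  rewrite !andbT; have [lt12|le21] := boolP (p i1 < p i2).
    apply: below_leq => [|k lt_k]; first by lia.
    have -> : k = i2 by apply: val_inj => /=; lia.
    by rewrite lt12.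
  (* Here the three letters decrease, hence so do their codes, and both sides are false. *)
  have := below_leqS p E2; rewrite (negbTE le21) => /negbT.
  have := below_leqS p (i := i2) (j := i3); rewrite E2 => /(_ E3).
  have -> : (p i2 < p i3) = false by lia.
  move=> /negbT; lia.
apply: (iffP (peaks_atP _ _)) => [pk i1 i2 i3 E2 E3 lt13 lt32|pk i].
  have := pk i1; rewrite size_lehmer -E3 -E2 !nth_lehmer cond // lt13 lt32.
  by move=> /(_ (ltn_ord i3) isT); rewrite E3.
rewrite size_lehmer => lt3.
have lt2 : i.+1 < n by lia.
have lt1 : i < n by lia.
rewrite (nth_lehmer p (Ordinal lt1)) (nth_lehmer p (Ordinal lt2)).
rewrite (nth_lehmer p (Ordinal lt3)) cond // => /andP[lt13 lt32].
exact: (pk (Ordinal lt1)).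
Qed.

Lemma avoidsP (w : 4.-tuple nat) p :
  reflect (forall i1 i2 i3 j : 'I_n, i2 = i1.+1 :> nat -> i3 = i1.+2 :> nat ->
             i3 < j ->
             ~~ order_iso [tuple p i1 : nat; p i2 : nat; p i3 : nat; p j : nat] w)
          (avoids w p).
Proof.
apply: (iffP negP) => [av i1 i2 i3 j E2 E3 lt_j|av].
  apply/negP => iso; apply: av; apply/existsP; exists i1; apply/existsP; exists i2.
  apply/existsP; exists i3; apply/existsP; exists j.
  by rewrite /occurrence E2 E3 !eqxx -E3 lt_j.
case/existsP=> i1 /existsP[i2 /existsP[i3 /existsP[j]]].
case/and4P=> /eqP E2 /eqP E3; rewrite -E3 => lt_j.
exact/negP/av.
Qed.

Lemma avoids1324_lehmer p :
  avoids [tuple 1; 3; 2; 4] p = peaks_at (fun m _ => m.+1) (lehmer p).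
Proof.
apply/avoidsP/peaks_at_lehmer => [av i1 i2 i3 E2 E3 lt13 lt32|pk i1 i2 i3 j E2 E3 lt_j].
  (* The prescribed value is the number of positions after [i2]; [i3 < n] keeps the truncated
     subtraction exact. *)
  have -> : (n - i1.+3).+1 = n - i2.+1 by have := ltn_ord i3; lia.
  apply/eqP; rewrite below_max; apply/forallP => j; apply/implyP => lt_2j.
  have [->//|neq3] := eqVneq j i3.
  have lt_3j : i3 < j by move: neq3; rewrite -(inj_eq val_inj) /=; lia.
  have := av i1 i2 i3 j E2 E3 lt_3j; rewrite order_iso1324 lt13 lt32 /=.
  by rewrite -perm_ltnNge //; lia.
rewrite order_iso1324; apply/negP => /and3P[lt13 lt32 lt_p].
have := pk i1 i2 i3 E2 E3 lt13 lt32.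
have -> : (n - i1.+3).+1 = n - i2.+1 by have := ltn_ord i3; lia.
move/eqP; rewrite below_max => /forallP/(_ j)/implyP; lia.
Qed.

Lemma avoids1423_lehmer p :
  avoids [tuple 1; 4; 2; 3] p = peaks_at (fun _ l => l.+1) (lehmer p).
Proof.
apply/avoidsP/peaks_at_lehmer => [av i1 i2 i3 E2 E3 lt13 lt32|pk i1 i2 i3 j E2 E3 lt_j].
  apply/eqP; rewrite below_succ ?E2 //; apply/forallP => j.
  apply/implyP => /andP[lt_3j lt_j2].
  have := av i1 i2 i3 j E2 E3 lt_3j; rewrite order_iso1423 lt13 lt_j2 andbT /=.
  by rewrite -perm_ltnNge //; lia.
rewrite order_iso1423; apply/negP => /and3P[lt13 lt_3j lt_j2].
have lt32 := ltn_trans lt_3j lt_j2.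
have /eqP := pk i1 i2 i3 E2 E3 lt13 lt32.
rewrite below_succ ?E2 // => /forallP/(_ j)/implyP; lia.
Qed.

End Lehmer.

Theorem theorem3p6 :
  des_Wilf_equiv [tuple 1; 3; 2; 4] [tuple 1; 4; 2; 3].
Proof.
move=> n m _.
have toP w g : (forall p : 'S_n, avoids w p = peaks_at g (lehmer p)) ->
    #|[set p in avoiders w n | des p == m]|
    = count (fun s => peaks_at g s && (code_des s == m)) (codes n).
  move=> av; rewrite -card_lehmer; apply: eq_card => p.
  by rewrite !inE av code_des_lehmer.
apply: etrans (toP _ _ (@avoids1324_lehmer n)) _.
apply: etrans _ (esym (toP _ _ (@avoids1423_lehmer n))).
(* Both [m.+1] and [l.+1] lie above [l] and at most at [m.+1] when [l <= m], so both are peak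
   rules. *)
by apply/eqP; rewrite eqn_leq !leq_count_peaks_at // => k l le_lk; lia.
Qed.
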